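(* Let $X$ be a closed subspace of $C_0[0,\omega_1)$ such that $X$ is isomorphic to $C_0[0,\omega_1)$. Then $X$ contains a closed subspace which is complemented in $C_0[0,\omega_1)$ and isomorphic to $C_0[0,\omega_1)$.
   Context: Scalars are in $\mathbb{K}=\mathbb{R}$ or $\mathbb{K}=\mathbb{C}$. $\omega_1$ is the first uncountable ordinal; $[0,\omega_1)$ carries the order topology. $C_0[0,\omega_1)$ is the Banach space (supremum norm) of continuous functions $[0,\omega_1)\to\mathbb{K}$ that vanish eventually. Isomorphic means linearly homeomorphic. *)

(* Defs.v *)
From HB Require Import structures.
From mathcomp Require Import all_boot all_order all_algebra.
From mathcomp Require Import all_classical all_reals all_analysis.
From mathcomp Require Import wochoice.
From mathcomp Require Import complex.

Set Implicit Arguments.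
Unset Strict Implicit.
Unset Printing Implicit Defensive.

Import Order.TTheory GRing.Theory Num.Theory.
Import numFieldNormedType.Exports.

Local Open Scope classical_set_scope.
Local Open Scope ring_scope.

(* We realize [0, omega_1) inside a well-ordering of the uncountable type
   [set nat], as the points that have only countably many predecessors.  The
   lemmas [omega1_wf], [omega1_countable_le] and [omega1_uncountable] below
   characterize it up to order isomorphism. *)

Definition wo_rel : rel (set nat) := sval (well_ordering_principle (set nat)).

Lemma wo_relP : well_order wo_rel.
Proof. exact: svalP (well_ordering_principle (set nat)). Qed.

Lemma wo_rel_min (A : set (set nat)) :
  A !=set0 -> exists2 x, A x & forall y, A y -> wo_rel x y.
Proof.
move=> [a Aa]; have [|x [[xA xmin] _]] := @wo_relP (fun x => `[< A x >]).
  by exists a; apply/asboolP.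
exists x; first exact/asboolP.
by move=> y Ay; apply: xmin; apply/asboolP.
Qed.

Lemma wo_rel_wochain : wo_chain wo_rel predT.
Proof. by move=> A _; exact: wo_relP. Qed.

Lemma wo_rel_total : total wo_rel.
Proof. by move=> x y; exact: (wo_chainW wo_rel_wochain). Qed.

Lemma wo_rel_refl : reflexive wo_rel.
Proof. by move=> x; exact: (wo_chain_reflexive wo_rel_wochain). Qed.

Lemma wo_rel_anti : antisymmetric wo_rel.
Proof. by move=> x y; exact: (wo_chain_antisymmetric wo_rel_wochain). Qed.

Lemma wo_rel_trans : transitive wo_rel.
Proof.
move=> y x z xy yz.
have [|m + mmin] := @wo_rel_min [set t | [\/ t = x, t = y | t = z]].
  by exists x; apply: Or31.
case=> mE; subst m.
- by apply: mmin; apply: Or33.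
- have <- // : y = x.
  by apply/wo_rel_anti; rewrite xy mmin//; apply: Or31.
- have -> : z = y by apply/wo_rel_anti; rewrite yz mmin//; apply: Or32.
  exact: xy.
Qed.

Definition countable_below (x : set nat) : bool :=
  `[< countable [set y | wo_rel y x] >].

Record omega1_carrier := Omega1 {
  omega1_val : set nat;
  omega1_valP : countable_below omega1_val }.

HB.instance Definition _ := [isSub for omega1_val].
HB.instance Definition _ := [Choice of omega1_carrier by <:].

Fact omega1_display : Order.disp_t. Proof. exact: Order.Disp tt tt. Qed.

Definition omega1_le : rel omega1_carrier :=
  fun x y => wo_rel (omega1_val x) (omega1_val y).

Lemma omega1_le_refl : reflexive omega1_le.
Proof. by move=> x; exact: wo_rel_refl. Qed.

Lemma omega1_le_anti : antisymmetric omega1_le.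
Proof. by move=> x y /wo_rel_anti /val_inj. Qed.

Lemma omega1_le_trans : transitive omega1_le.
Proof. by move=> y x z; exact: wo_rel_trans. Qed.

Lemma omega1_le_total : total omega1_le.
Proof. by move=> x y; exact: wo_rel_total. Qed.

HB.instance Definition _ := Order.Le_isPOrder.Build omega1_display
  omega1_carrier omega1_le_refl omega1_le_anti omega1_le_trans.
HB.instance Definition _ := Order.POrder_isTotal.Build omega1_display
  omega1_carrier omega1_le_total.

Definition omega1 : orderTopologicalType omega1_display :=
  order_topology omega1_carrier.

Lemma omega1_wf (A : set omega1) :
  A !=set0 -> exists2 x, A x & forall y, A y -> (x <= y)%O.
Proof.
move=> [a Aa].
have [|x [x' Ax' <-] xmin] := @wo_rel_min (omega1_val @` A).
  by exists (omega1_val a); exists a.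
by exists x' => // y Ay; apply: xmin; exists y.
Qed.

Lemma omega1_countable_le (x : omega1) : countable [set y : omega1 | (y <= x)%O].
Proof.
have /asboolP/countable_injP[f finj] := omega1_valP x.
apply/countable_injP; exists (f \o omega1_val) => y z.
rewrite !inE => yx zx /= fyz; apply: val_inj.
by apply: finj => //; rewrite inE.
Qed.

Lemma set_nat_uncountable : ~ countable [set: set nat].
Proof.
move=> /countable_injP[f finj].
pose D := [set n | exists2 A, f A = n & ~ A n].
have nD : ~ D (f D).
  move=> [A fA nA]; apply: (nA).
  have -> : A = D by apply: finj; rewrite ?inE.
  by exists A.
by apply: (nD); exists D.
Qed.

Lemma omega1_uncountable : ~ countable [set: omega1].
Proof.
move=> ctb.
have ctb' : countable [set x | countable_below x].
  apply: (@sub_countable _ _ _ (omega1_val @` [set: omega1])).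
    by apply: subset_card_le => x bx; exists (Omega1 bx).
  by apply: sub_countable ctb; exact: card_image_le.
have [allb|/existsNP[x0 /negP nx0]] := pselect (forall x, countable_below x).
  apply: set_nat_uncountable; apply: sub_countable ctb'.
  by apply: subset_card_le => x _; exact: allb.
have [|x /negP nx xmin] := @wo_rel_min [set x | ~ countable_below x].
  by exists x0; apply/negP.
apply: (negP nx); apply/asboolP.
apply: (@sub_countable _ _ _ ([set x | countable_below x] `|` [set x])); last first.
  rewrite -bigcup2E; apply: bigcup_countable => // i _.
  case: i => [|[|i]]; [exact: ctb'|exact: countable1|exact: countable0].
apply: subset_card_le => y yx.
have [by_|/negP/xmin xy] := boolP (countable_below y); first by left.
by right; apply/wo_rel_anti; rewrite yx xy.
Qed.

Section C0_omega1.
Variable K : numFieldType.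

Definition is_C0 : {pred omega1 -> K} :=
  mem [set f : omega1 -> K |
    continuous f /\ exists a : omega1, forall b, (a <= b)%O -> f b = 0].

Record C0 := MkC0 {
  C0_fun :> omega1 -> K;
  C0_funP : C0_fun \in is_C0 }.

HB.instance Definition _ := [isSub for C0_fun].
HB.instance Definition _ := [Choice of C0 by <:].

Lemma is_C0_submod_closed : submod_closed is_C0.
Proof.
split.
  rewrite inE; split; first exact: cst_continuous.
  have [|a _ _] := @omega1_wf setT.
    apply: contrapT => W0; apply: omega1_uncountable.
    rewrite (_ : [set: omega1] = set0) ?countable0//.
    by rewrite -subset0 => x _; apply: W0; exists x.
  by exists a.
move=> c f g; rewrite !inE => -[fc [a fa]] [gc [b gb]]; split.
  move=> x; apply: (@cvgD _ _ _ (nbhs x) _ (fun y => c * f y) g).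
    by apply: cvgM; [exact: cvg_cst|exact: fc].
  exact: gc.
exists (Order.max a b) => x; rewrite ge_max => /andP[ax bx].
by rewrite /= !fctE fa// gb// scaler0 addr0.
Qed.

HB.instance Definition _ :=
  GRing.isSubmodClosed.Build _ _ is_C0 is_C0_submod_closed.
HB.instance Definition _ := [SubChoice_isSubLmodule of C0 by <:].

Lemma C0_bounded_max (f : omega1 -> K) : continuous f -> forall a : omega1,
  exists2 m, (m <= a)%O & forall x, (x <= a)%O -> `|f x| <= `|f m|.
Proof.
move=> fc a; apply: contrapT => na.
pose A := [set a : omega1 | ~ exists2 m, (m <= a)%O &
  forall x, (x <= a)%O -> `|f x| <= `|f m|].
have [|{na}a Aa amin] := @omega1_wf A; first by exists a.
apply: Aa.
have [dle|/existsNP[d /not_implyP[da /negP]]] :=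
    pselect (forall d, (d < a)%O -> `|f d| <= `|f a|).
  exists a => // x; rewrite le_eqVlt => /predU1P[-> //|]; exact: dle.
rewrite -real_ltNge// => fad.
have e0 : 0 < `|f d| - `|f a| by rewrite subr_gt0.
have [c ca cP] : exists2 c : omega1, (c < a)%O &
    (d <= c)%O /\ forall x, (c < x)%O -> (x <= a)%O -> `|f x| <= `|f d|.
  have : nbhs a [set x | `|f a - f x| < `|f d| - `|f a|].
    by move/cvgrPdist_lt : (fc a) => /(_ _ e0).
  have lefd x : `|f a - f x| < `|f d| - `|f a| -> `|f x| <= `|f d|.
    move=> fax; have -> : f x = f a - (f a - f x) by rewrite opprB addrC subrK.
    by rewrite (le_trans (ler_normB _ _))// -lerBrDl ltW.
  rewrite itv_nbhsE => -[[[bl l|[]] r] [io ai] sub].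
  - have la : (l < a)%O.
      move: io ai; rewrite /itv_open_ends.
      by case: bl r {sub} => [] [[]?|[]]//= _; rewrite in_itv /= => /andP[].
    exists (Order.max l d); first by rewrite gt_max la da.
    split; first by rewrite le_max lexx orbT.
    move=> x; rewrite gt_max => /andP[lx dx] xa; apply: lefd; apply: sub => /=.
    rewrite itv_boundlr; move: ai; rewrite itv_boundlr => /andP[_ ar].
    rewrite (le_trans _ ar) ?bnd_simp// andbT.
    by case: bl io => ?; rewrite bnd_simp ?ltW.
  - exists d => //; split => // x dx xa; apply: lefd; apply: sub => /=.
    rewrite itv_boundlr; move: ai; rewrite itv_boundlr => /andP[_ ar].
    by rewrite (le_trans _ ar) ?bnd_simp.
  - by move: ai; rewrite in_itv.
have [m mc mP] : exists2 m, (m <= c)%O &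
    forall x, (x <= c)%O -> `|f x| <= `|f m|.
  by apply: contrapT => /amin; rewrite leNgt ca.
exists m => [|x xa]; first exact: (le_trans mc (ltW ca)).
have [xc|cx] := leP x c; first exact: mP.
by rewrite (le_trans (cP.2 _ cx xa))// mP// cP.1.
Qed.

Lemma C0_max (f : C0) : exists m, forall x, `|f x| <= `|f m|.
Proof.
have := C0_funP f; rewrite inE => -[fc [a fa]].
have [m _ mP] := C0_bounded_max fc a; exists m => x.
have [/mP//|/ltW/fa ->] := leP x a.
by rewrite normr0.
Qed.

(* [supremum] is the least upper bound in the partially ordered set [K]: the
   values [`|f x|] are nonnegative, hence real even when [K] is complex. *)
Definition sup_norm (f : C0) : K := supremum 0 (range (fun x => `|f x|)).

Lemma sup_norm_max (f : C0) m :
  (forall x, `|f x| <= `|f m|) -> sup_norm f = `|f m|.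
Proof.
move=> mP; rewrite /sup_norm /supremum ifF; last first.
  by apply/negbTE/set0P; exists `|f m|, m.
apply: xget_subset1; last exact: is_subset1_supremums.
split; first by move=> _ [x _ <-]; exact: mP.
by move=> u; apply; exists m.
Qed.

Lemma sup_norm_ge (f : C0) x : `|f x| <= sup_norm f.
Proof. by have [m mP] := C0_max f; rewrite (sup_norm_max mP). Qed.

Lemma sup_norm_le (f : C0) c : (forall x, `|f x| <= c) -> sup_norm f <= c.
Proof. by have [m mP] := C0_max f; rewrite (sup_norm_max mP). Qed.

Lemma sup_normD (f g : C0) : sup_norm (f + g) <= sup_norm f + sup_norm g.
Proof.
apply: sup_norm_le => x; rewrite (le_trans (ler_normD _ _))//.
by rewrite lerD ?sup_norm_ge.
Qed.

Lemma sup_normZ c (f : C0) : sup_norm (c *: f) = `|c| * sup_norm f.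
Proof.
have [m mP] := C0_max f; rewrite (sup_norm_max mP) -normrM.
by apply: (@sup_norm_max (c *: f)) => x; rewrite !normrM ler_wpM2l.
Qed.

Lemma sup_norm_eq0 (f : C0) : sup_norm f = 0 -> f = 0.
Proof.
move=> f0; apply/val_inj/funext => x; apply/eqP.
by rewrite -normr_le0 -f0 sup_norm_ge.
Qed.

HB.instance Definition _ :=
  Lmodule_isNormed.Build K C0 sup_normD sup_normZ sup_norm_eq0.

End C0_omega1.

Section subspaces.
Variables (K : numFieldType) (V W : normedModType K).

Definition closed_subspace (X : set V) :=
  submod_closed [in X] /\ closed X.

Definition linear_on (X : set V) (f : V -> W) :=
  forall a u v, X u -> X v -> f (a *: u + v) = a *: f u + f v.

(* The values of [f] outside [X] and of [g] outside [Y] are irrelevant. *)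
Definition isomorphic (X : set V) (Y : set W) :=
  exists (f : V -> W) (g : W -> V),
    [/\ set_fun X Y f, set_fun Y X g,
        (forall x, X x -> g (f x) = x) & (forall y, Y y -> f (g y) = y)] /\
    [/\ linear_on X f, {within X, continuous f} & {within Y, continuous g}].

Definition complemented (X : set V) :=
  exists P : {linear V -> V},
    [/\ continuous P, (forall x, P (P x) = P x) & range P = X].

End subspaces.

(* Main.v *)
(* Let [T] be an isomorphism of C_0[0,omega_1) onto [X].  Testing [T] on the
   indicators of the initial segments [0,b], whose span is dense, one finds a
   club of points [d] at which the functional [f |-> T f d] is a multiple
   [lam d] of the evaluation at [d].  The modulus of [lam] is bounded below,
   because a small [lam d] lets [T] map a ramp of norm [N], built from [N]
   indicators of intervals below [d], to a function of norm much smaller than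
   [N].  If [e] enumerates the club and [s] is its left inverse, then dividing
   [(T (f \o s)) \o e] by [lam \o e] recovers [f], so that
   [f |-> T (f \o s)] is an isomorphism onto a complemented subspace of [X]. *)

From HB Require Import structures.
Require Import Defs.
From mathcomp Require Import all_boot all_order all_algebra.
From mathcomp Require Import all_classical all_reals all_analysis.
From mathcomp Require Import complex.

Set Implicit Arguments.
Unset Strict Implicit.
Unset Printing Implicit Defensive.

Import Order.TTheory GRing.Theory Num.Theory.
Import numFieldNormedType.Exports.

Local Open Scope classical_set_scope.
Local Open Scope ring_scope.

(** * Bounds, suprema and neighbourhoods in [0, omega_1) *)

Lemma omega1_countable_ub (A : set omega1) :
  countable A -> exists b : omega1, forall a, A a -> (a <= b)%O.
Proof.
move=> cA; apply: contrapT => nb; apply: omega1_uncountable.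
apply: (@sub_countable _ _ _ (\bigcup_(a in A) [set y : omega1 | (y <= a)%O])).
  apply: subset_card_le => b _; apply: contrapT => nAb; apply: nb; exists b => a Aa.
  by rewrite leNgt; apply/negP => /ltW ba; apply: nAb; exists a.
by apply: bigcup_countable => // a _; exact: omega1_countable_le.
Qed.

Lemma omega1_gt (a : omega1) : exists b : omega1, (a < b)%O.
Proof.
apply: contrapT => na; apply: omega1_uncountable.
apply: sub_countable (omega1_countable_le a).
by apply: subset_card_le => b _ /=; rewrite leNgt; apply/negP => ab; apply: na; exists b.
Qed.

Lemma omega1_image_ub (I : Type) (A : set I) (f : I -> omega1) :
  countable A -> exists b : omega1, forall i, A i -> (f i < b)%O.
Proof.
move=> cA; have [b Ab] : exists b : omega1, forall a, (f @` A) a -> (a <= b)%O.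
  by apply: omega1_countable_ub; exact: sub_countable (card_image_le _ _) cA.
have [c bc] := omega1_gt b; exists c => i Ai.
by apply: le_lt_trans bc; apply: Ab; exists i.
Qed.

Lemma omega1_lt_wf : well_founded (fun x y : omega1 => (x < y)%O).
Proof.
move=> x; apply: contrapT => nx.
have [|m nm mmin] := @omega1_wf [set x | ~ Acc (fun x y : omega1 => (x < y)%O) x].
  by exists x.
apply: nm; apply: Acc_intro => y ym; apply: contrapT => /mmin.
by rewrite leNgt ym.
Qed.

Lemma omega1_lub (A : set omega1) b : (forall a, A a -> (a <= b)%O) ->
  exists z : omega1, (forall a, A a -> (a <= z)%O) /\
    forall y, (y < z)%O -> exists2 a, A a & (y < a)%O.
Proof.
move=> Ab; have [|z Az zmin] := @omega1_wf [set z | forall a, A a -> (a <= z)%O].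
  by exists b.
exists z; split => // y yz; apply: contrapT => ny.
have : (z <= y)%O; last by rewrite leNgt yz.
apply: zmin => a Aa; rewrite leNgt; apply/negP => ya; apply: ny; by exists a.
Qed.

(* Successors make [c, x] clopen, so only the left side of a neighbourhood matters. *)
Lemma omega1_nbhsE (a : omega1) (U : set omega1) : nbhs a U <->
  (exists2 c, (c < a)%O & forall x, (c < x)%O -> (x <= a)%O -> U x) \/
  (forall x, (x <= a)%O -> U x).
Proof.
have [b ab bmin] := omega1_wf (omega1_gt a).
split.
  rewrite itv_nbhsE => -[[[bl l|[]] r] [io ai] sub].
  - have la : (l < a)%O.
      move: io ai; rewrite /itv_open_ends.
      by case: bl r {sub} => [] [[]?|[]]//= _; rewrite in_itv /= => /andP[].
    left; exists l => // x lx xa; apply: sub => /=.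
    rewrite itv_boundlr; move: ai; rewrite itv_boundlr => /andP[_ ar].
    rewrite (le_trans _ ar) ?bnd_simp// andbT.
    by case: bl io => ?; rewrite bnd_simp ?ltW.
  - right => x xa; apply: sub => /=.
    rewrite itv_boundlr; move: ai; rewrite itv_boundlr => /andP[_ ar].
    by rewrite (le_trans _ ar) ?bnd_simp.
  - by move: ai; rewrite in_itv.
have ltb x : (x < b)%O -> (x <= a)%O.
  by move=> xb; rewrite leNgt; apply/negP => /bmin; rewrite leNgt xb.
case=> [[c ca cU]|aU].
  apply: (@filterS _ _ _ `]c, b[%classic).
    by move=> x /=; rewrite in_itv /= => /andP[cx /ltb]; exact: cU.
  by apply: open_nbhs_nbhs; split; [exact: itv_open|rewrite /= in_itv /= ca].
apply: (@filterS _ _ _ `]-oo, b[%classic).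
  by move=> x /=; rewrite in_itv /= => /ltb; exact: aU.
by apply: open_nbhs_nbhs; split; [exact: lray_open|rewrite /= in_itv].
Qed.

(** * Functions in C_0 and indicators of initial segments *)

Section C0_lemmas.
Variable K : numFieldType.

(** Falls back to 0 outside the space, so its value is informative only through [toC0E]. *)
Definition toC0 (f : omega1 -> K) : C0 K := insubd 0 f.

Lemma toC0E (f : omega1 -> K) : continuous f ->
  (exists a : omega1, forall b, (a <= b)%O -> f b = 0) -> toC0 f = f :> (omega1 -> K).
Proof.
move=> fc f0; have fP : f \in @is_C0 K by rewrite inE.
exact: (insubdK _ fP).
Qed.

Lemma C0_continuous (f : C0 K) : continuous f.
Proof. by have := C0_funP f; rewrite inE => -[]. Qed.

Lemma C0_eventually (f : C0 K) : exists a : omega1, forall b, (a <= b)%O -> f b = 0.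
Proof. by have := C0_funP f; rewrite inE => -[]. Qed.

Lemma C0P (f g : C0 K) : (forall x, f x = g x) -> f = g.
Proof. by move=> fg; apply/val_inj/funext. Qed.

Lemma C0D (f g : C0 K) x : (f + g) x = f x + g x. Proof. by []. Qed.
Lemma C0B (f g : C0 K) x : (f - g) x = f x - g x. Proof. by []. Qed.
Lemma C0Z a (f : C0 K) x : (a *: f) x = a * f x. Proof. by []. Qed.
Lemma C0_sum (I : Type) (r : seq I) (F : I -> C0 K) x :
  (\sum_(i <- r) F i) x = \sum_(i <- r) F i x.
Proof. by elim/big_ind2 : _ => // a b c d <- <-. Qed.

Lemma C0_norm_ge (f : C0 K) x : `|f x| <= `|f|.
Proof. exact: sup_norm_ge. Qed.

Lemma C0_norm_le (f : C0 K) c : (forall x, `|f x| <= c) -> `|f| <= c.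
Proof. exact: sup_norm_le. Qed.

Definition seg (b : omega1) : C0 K := toC0 (fun x => (x <= b)%O%:R).

Lemma segE b x : seg b x = (x <= b)%O%:R.
Proof.
rewrite toC0E//.
  move=> a; apply: (@cvg_near_cst _ _ _ _ (nbhs a)).
  apply/omega1_nbhsE; have [ab|ba] := leP a b.
    by right => y /le_trans ->.
  by left; exists b => // y yb _; rewrite leNgt yb.
have [c bc] := omega1_gt b; exists c => a ca.
by rewrite leNgt (lt_le_trans bc ca).
Qed.

End C0_lemmas.

(** * Bounded functionals tested on the indicators *)

Section forms.
Variable K : numFieldType.

(** [P] stands for any property that holds on the span of the indicators. Transfinite induction on
    [a] approximates [f] on [0, a]: [f] is within [eps] of [f a] on some (c, a], so an approximation
    up to [c] is extended by the step [f a *: (seg K a - seg K c)]. *)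
Lemma seg_dense (P : C0 K -> Prop) :
  P 0 -> (forall c b g, P g -> P (c *: seg K b + g)) ->
  forall f eps, 0 < eps -> exists2 g, P g & `|f - g| <= eps.
Proof.
move=> P0 PD f eps e0.
suff approx (a : omega1) : exists g, [/\ P g,
    forall x, (x <= a)%O -> `|f x - g x| <= eps & forall x, (a < x)%O -> g x = 0].
  have [a fa] := C0_eventually f; have [g [Pg fg ga]] := approx a.
  exists g => //; apply: C0_norm_le => x; rewrite C0B.
  have [/fg//|ax] := leP x a.
  by rewrite fa ?(ltW ax)// ga// subrr normr0 ltW.
elim/(well_founded_ind omega1_lt_wf) : a => a IH.
have : nbhs a [set x | `|f a - f x| < eps].
  by move/cvgrPdist_lt : (@C0_continuous _ f a) => /(_ _ e0).
have dist_sym x : `|f a - f x| < eps -> `|f x - f a| <= eps.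
  by rewrite distrC => /ltW.
move=> /omega1_nbhsE[[c ca cP]|aP].
  have [g [Pg fg gc]] := IH c ca.
  exists (f a *: seg K a + (- f a *: seg K c + g)); split; first exact/PD/PD.
    move=> x xa; rewrite !C0D !C0Z !segE xa.
    have [xc|cx] := leP x c; first by rewrite addrA mulr1 mulNr mulr1 subrr add0r fg.
    by rewrite mulr0 gc// !addr0 mulr1 dist_sym// cP.
  move=> x ax; have cx := lt_trans ca ax.
  by rewrite !C0D !C0Z !segE !leNgt ax cx gc// !mulr0 !addr0.
exists (f a *: seg K a + 0); split; first exact: PD.
  by move=> x xa; rewrite C0D C0Z segE xa mulr1 addr0 dist_sym// aP.
by move=> x ax; rewrite C0D C0Z segE leNgt ax mulr0 addr0.
Qed.

Definition bounded_form (phi : C0 K -> K) (M : K) :=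
  (forall a f g, phi (a *: f + g) = a * phi f + phi g) /\
  (forall f, `|phi f| <= M * `|f|).

Variables (phi : C0 K -> K) (M : K).
Hypotheses (M0 : 0 <= M) (phiP : bounded_form phi M).

Lemma formB f g : phi (f - g) = phi f - phi g.
Proof. by rewrite addrC -scaleN1r phiP.1 mulN1r addrC. Qed.

Lemma form0 : phi 0 = 0.
Proof. by rewrite -(subrr 0) formB subrr. Qed.

Lemma form_seg_eq0 : (forall b, phi (seg K b) = 0) -> forall f, phi f = 0.
Proof.
move=> phi0 f; apply: contrapT => /eqP nf.
have M1 : 0 < M + 1 by rewrite ltr_wpDl.
(* Dividing by [M + 1] keeps [M] times this error strictly below the norm of [phi f]. *)
have e0 : 0 < `|phi f| / (M + 1) by rewrite divr_gt0 ?normr_gt0.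
have [||g phig fg] := @seg_dense (fun g => phi g = 0) _ _ f _ e0.
- exact: form0.
- by move=> c b g phig; rewrite phiP.1 phi0 phig mulr0 addr0.
have : `|phi f| <= M * (`|phi f| / (M + 1)).
  rewrite {1}(_ : phi f = phi (f - g)); last by rewrite formB phig subr0.
  by rewrite (le_trans (phiP.2 _))// ler_wpM2l.
rewrite mulrCA ler_pMr ?normr_gt0// ler_pdivlMr// mul1r gerDl.
by rewrite ler10.
Qed.

Hypothesis arch : forall x : K, exists n : nat, `|x| < n%:R.

(* The values [phi (seg b)] have variation at most [M]. *)
Lemma form_seg_cauchy eps : 0 < eps ->
  exists a : omega1, forall b b', (a <= b)%O -> (a <= b')%O ->
    `|phi (seg K b) - phi (seg K b')| <= eps.
Proof.
move=> e0; apply: contrapT => na.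
have jump (a : omega1) : exists b b', [/\ (a <= b)%O, (a <= b')%O &
    eps < `|phi (seg K b) - phi (seg K b')|].
  apply: contrapT => nb; apply: na; exists a => b b' ab ab'.
  rewrite real_leNgt ?(gtr0_real e0) ?normr_real//; apply/negP => bb'.
  by apply: nb; exists b, b'.
have [z _] := C0_eventually (0 : C0 K).
(* Jumps are added one at a time. The new difference vanishes on [0, c], outside of which the
   previous [f] is 0, so the norm stays at most 1; the unimodular factor in front of it makes [phi]
   grow by more than [eps]. *)
have step n : exists (f : C0 K) (a : omega1), [/\ `|f| <= 1, forall x, (a < x)%O -> f x = 0 &
    n%:R * eps <= phi f].
  elim: n => [|n [f [c [f1 fc nf]]]].
    by exists 0, z; split; rewrite ?normr0// form0 mul0r.
  have [b [b' [ab ab' bb']]] := jump c.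
  have j0 : phi (seg K b) - phi (seg K b') != 0.
    by rewrite -normr_gt0 (lt_trans e0).
  set j := phi _ - _ in bb' j0.
  exists (`|j| / j *: (seg K b - seg K b') + f), (Order.max b b'); split.
  - apply: C0_norm_le => x; rewrite C0D C0Z C0B !segE.
    have [xa|ax] := leP x c.
      rewrite !(le_trans xa)// subrr mulr0 add0r.
      exact: le_trans (C0_norm_ge _ _) f1.
    rewrite fc// addr0 normrM normrM normfV normr_id divff ?normr_eq0// mul1r.
    by case: (x <= b)%O; case: (x <= b')%O;
      rewrite ?subrr ?sub0r ?subr0 ?normrN ?normr1 ?normr0.
  - move=> x; rewrite gt_max => /andP[bx b'x].
    rewrite C0D C0Z C0B !segE !leNgt bx b'x subrr mulr0 add0r fc//.
    exact: le_lt_trans ab bx.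
  - by rewrite phiP.1 formB -/j divfK// -[n.+1]addn1 natrD mulrDl mul1r addrC lerD// ltW.
have [n Mn] := arch (M / eps); have [f [_ [f1 _ nf]]] := step n.
have n0 : 0 <= n%:R * eps by rewrite mulr_ge0// ltW.
have : n%:R * eps <= M.
  rewrite (le_trans nf)// -[phi f]ger0_norm ?(le_trans n0)//.
  by rewrite (le_trans (phiP.2 _))// ler_piMr.
rewrite -ler_pdivlMr// => /le_lt_trans; rewrite -[M / eps]ger0_norm ?divr_ge0 ?(ltW e0)//.
by move=> /(_ _ Mn); rewrite ltxx.
Qed.

(** The thresholds for the tolerances 1/(n+1) are countably many, hence have a common bound below
    omega_1. Beyond it the oscillation is at most every 1/(n+1), so it is zero. *)
Lemma form_seg_cst : exists a : omega1, forall b b', (a <= b)%O -> (a <= b')%O ->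
  phi (seg K b) = phi (seg K b').
Proof.
have /choice[A AP] n : exists a : omega1, forall b b', (a <= b)%O -> (a <= b')%O ->
    `|phi (seg K b) - phi (seg K b')| <= n.+1%:R^-1.
  by apply: form_seg_cauchy; rewrite invr_gt0.
have [a aP] := @omega1_image_ub _ setT A (countableP _).
exists a => b b' ab ab'; apply: contrapT => /eqP; rewrite -subr_eq0 -normr_gt0.
set d := `|_| => d0; have [n dn] := arch d^-1.
have : d <= n.+1%:R^-1.
  by apply: AP; [apply: le_trans ab|apply: le_trans ab']; rewrite ltW ?aP.
rewrite -[d]invrK lef_pV2 ?posrE ?invr_gt0// => nd.
move: dn; rewrite gtr0_norm ?invr_gt0// => /(le_lt_trans nd).
by rewrite ltr_nat ltnNge leqnSn.
Qed.
End forms.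

(** * Action of a bounded operator on the indicators *)

Section operators.
Variables (K : numFieldType) (T : {linear C0 K -> C0 K}) (M : K).
Hypotheses (M0 : 0 <= M) (TM : forall f, `|T f| <= M * `|f|).
Hypothesis arch : forall x : K, exists n : nat, `|x| < n%:R.

Lemma operator_form x : bounded_form (fun f => T f x) M.
Proof.
split=> [a f g|f]; first by rewrite linearP.
exact: le_trans (C0_norm_ge _ _) (TM f).
Qed.

(** Each [T (seg K b)] vanishes eventually, and each functional [fun f => T f y] is eventually
    constant on indicators by [form_seg_cst]. As [0, p] is countable, one [h] exceeds the thresholds
    for all [b] and [y] up to [p]. *)
Lemma operator_separation (p : omega1) : exists h : omega1, [/\ (p < h)%O,
  forall b x, (b <= p)%O -> (h <= x)%O -> T (seg K b) x = 0 &
  forall y b b', (y <= p)%O -> (h <= b)%O -> (h <= b')%O ->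
    T (seg K b) y = T (seg K b') y].
Proof.
have /choice[z zP] b : exists a : omega1, forall x, (a <= x)%O -> T (seg K b) x = 0.
  exact: C0_eventually.
have /choice[k kP] y := form_seg_cst M0 (operator_form y) arch.
have cp := omega1_countable_le p.
have [hz hzP] := omega1_image_ub z cp; have [hk hkP] := omega1_image_ub k cp.
have [hp php] := omega1_gt p.
exists (Order.max hp (Order.max hz hk)); split; first by rewrite lt_max php.
- move=> b x bp; rewrite !ge_max => /and3P[_ hx _].
  by apply: zP; apply: le_trans hx; rewrite ltW ?hzP.
- move=> y b b' yp; rewrite !ge_max => /and3P[_ _ hb] /and3P[_ _ hb'].
  by apply: kP; [apply: le_trans hb|apply: le_trans hb']; rewrite ltW ?hkP.
Qed.

End operators.

(** * Closed unbounded sets, their enumeration and its left inverse *)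

Lemma closure_points_unbounded (H : omega1 -> omega1) (p : omega1) :
  exists d : omega1, (p < d)%O /\ forall q, (q < d)%O -> (H q < d)%O.
Proof.
have /choice[h hP] q : exists b : omega1, (q < b)%O /\
    forall r, (r <= q)%O -> (H r < b)%O.
  have [b bP] := omega1_image_ub H (omega1_countable_le q).
  have [c qc] := omega1_gt q; exists (Order.max b c); rewrite lt_max qc orbT.
  by split => // r /bP rb; rewrite lt_max rb.
(* The supremum [d] of these iterates is closed under [H]: a point below [d] is below some [u n],
   where [H] is bounded by [u n.+1]. *)
pose u n := iter n h p.
have [b ub] := @omega1_image_ub _ setT u (countableP _).
have [|d [ud dmin]] := @omega1_lub (range u) b; first by move=> _ [n _ <-]; rewrite ltW ?ub.
have uS n : (u n.+1 <= d)%O by apply: ud; exists n.+1.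
exists d; split; first exact: lt_le_trans (hP p).1 (uS 0).
move=> q /dmin[_ [n _ <-] qn].
by apply: lt_le_trans (uS n); apply: (hP _).2; exact: ltW.
Qed.

Section club.
Variable D : set omega1.
Hypothesis D_unbounded : forall p : omega1, exists2 d, D d & (p < d)%O.
Hypothesis D_closed : forall z p : omega1, (p < z)%O ->
  (forall q, (q < z)%O -> exists2 d, D d & (q < d <= z)%O) -> D z.

(** Well-founded recursion: [e a] is the least element of [D] above all earlier values, which form a
    countable set and so are bounded. *)
Lemma club_enum : exists e : omega1 -> omega1, [/\ forall a, D (e a),
  forall a b, (b < a)%O -> (e b < e a)%O &
  forall a z, D z -> (forall b, (b < a)%O -> (e b < z)%O) -> (e a <= z)%O].
Proof.
have /choice[nxt nxtP] (A : set omega1) : exists z, countable A ->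
    [/\ D z, forall a, A a -> (a < z)%O &
     forall y, D y -> (forall a, A a -> (a < y)%O) -> (z <= y)%O].
  have [cA|ncA] := pselect (countable A); last first.
    (* An uncountable [A] receives an arbitrary point. *)
    by have [z _] := omega1_countable_ub (countable0 omega1); exists z.
  have [b Ab] := omega1_image_ub id cA; have [d Dd bd] := D_unbounded b.
  have [|z [Dz zA] zmin] := @omega1_wf [set z | D z /\ forall a, A a -> (a < z)%O].
    by exists d; split => // a /Ab /lt_trans; apply.
  by exists z => _; split => // y Dy yA; exact: zmin.
pose F (a : omega1) (rec : forall b : omega1, (b < a)%O -> omega1) : omega1 :=
  nxt [set z | exists b (ba : (b < a)%O), z = rec b ba].
pose e := Fix omega1_lt_wf (fun _ => omega1) F.
have eE a : e a = nxt (e @` [set b | (b < a)%O]).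
  rewrite /e Fix_eq; last first.
    by move=> x f g fg; congr F; apply/functional_extensionality_dep => y;
       apply/functional_extensionality_dep => yx; exact: fg.
  congr nxt; apply/seteqP; split => [z [b [ba ->]]|z [b ba <-]]; first by exists b.
  by exists b, ba.
have eP a : [/\ D (e a), forall z, (e @` [set b | (b < a)%O]) z -> (z < e a)%O &
    forall y, D y -> (forall z, (e @` [set b | (b < a)%O]) z -> (z < y)%O) -> (e a <= y)%O].
  rewrite [e a]eE; apply: nxtP.
  apply: sub_countable (card_image_le _ _) _.
  by apply: sub_countable (omega1_countable_le a); apply: subset_card_le => b /ltW.
exists e; split => [a|a b ba|a z Dz za]; have [De elt emin] := eP a => //.
  by apply: elt; exists b.
by apply: emin => // _ [b ba <-]; exact: za.
Qed.

(** [s x] is the least [a] with [x <= e a], so that [c < s x] exactly when [e c < x]; this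
    adjunction gives the continuity of [s]. Continuity of [e] rests on [D] being closed. *)
Lemma club_retraction : exists e s : omega1 -> omega1,
  [/\ continuous e, continuous s, forall a, D (e a), cancel e s &
      [/\ forall a, (a <= e a)%O, {homo e : a b / (a <= b)%O} &
      {homo s : a b / (a <= b)%O}]].
Proof.
have [e [De elt emin]] := club_enum.
have ele a b : (a <= b)%O -> (e a <= e b)%O.
  by rewrite le_eqVlt => /predU1P[->//|/elt/ltW].
have a_le a : (a <= e a)%O.
  rewrite leNgt; apply/negP => ea.
  have [|m em mmin] := @omega1_wf [set a | (e a < a)%O]; first by exists a.
  by have := mmin _ (elt _ _ em); rewrite leNgt em.
have /choice[s sP] x : exists a, (x <= e a)%O /\ forall b, (x <= e b)%O -> (a <= b)%O.
  have [|a xa amin] := @omega1_wf [set a | (x <= e a)%O]; first by exists x; exact: a_le.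
  by exists a.
have sle a b : (a <= b)%O -> (s a <= s b)%O.
  by move=> ab; apply: (sP a).2; apply: le_trans ab (sP b).1.
have lts x c : (c < s x)%O = (e c < x)%O.
  apply/idP/idP; rewrite !ltNge; apply: contraNN; first exact: (sP x).2.
  by move=> /ele; apply: le_trans (sP x).1.
exists e, s; split => //.
- move=> a U /omega1_nbhsE eU; apply/omega1_nbhsE.
  case: eU => [[c ca cU]|eU]; last by right => x /ele; exact: eU.
  have [[b ba cb]|nb] := pselect (exists2 b, (b < a)%O & (c <= e b)%O).
    left; exists b => // x bx xa; apply: cU; last exact: ele.
    exact: le_lt_trans cb (elt _ _ bx).
  (* Now all earlier values lie below [c]. If [a] is a successor or the least point, some left
     neighbourhood of [a] is trivial to handle; limits are shown to be impossible. *)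
  have {}nb b : (b < a)%O -> (e b < c)%O.
    by move=> ba; rewrite ltNge; apply/negP => cb; apply: nb; exists b.
  have [[b ba bmax]|nlim] := pselect (exists2 b, (b < a)%O & forall x, (x < a)%O -> (x <= b)%O).
    left; exists b => // x bx xa; suff -> : x = a by exact: cU.
    by apply/le_anti; rewrite xa leNgt; apply/negP => /bmax; rewrite leNgt bx.
  have [[b ba]|amin] := pselect (exists b, (b < a)%O); last first.
    right => x; rewrite le_eqVlt => /predU1P[->|xa]; first exact: cU.
    by exfalso; apply: amin; exists x.
  have lim x : (x < a)%O -> exists2 y, (y < a)%O & (x < y)%O.
    move=> xa; apply: contrapT => ny; apply: nlim; exists x => // y ya.
    by rewrite leNgt; apply/negP => xy; apply: ny; exists y.
  (* At a limit [a] the supremum [z] of the earlier values is in [D], so minimality yields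
     [e a <= z <= c], against [c < e a]. *)
  have [|z [ez zmin]] := @omega1_lub (e @` [set b | (b < a)%O]) c.
    by move=> _ [y ya <-]; exact/ltW/nb.
  have eltz y : (y < a)%O -> (e y < z)%O.
    move=> /lim[y' y'a yy']; apply: lt_le_trans (elt _ _ yy') _.
    by apply: ez; exists y'.
  have Dz : D z.
    apply: (D_closed (eltz _ ba)) => q /zmin[_ [y ya <-] qy].
    by exists (e y) => //; rewrite qy ltW ?eltz.
  exfalso; have := emin _ _ Dz eltz; rewrite leNgt => /negP; apply.
  apply: le_lt_trans ca; rewrite leNgt; apply/negP => /zmin[_ [y ya <-]].
  by rewrite ltNge ltW ?nb.
- move=> x U /omega1_nbhsE sU; apply/omega1_nbhsE.
  case: sU => [[c cx cU]|sU]; last by right => y /sle; exact: sU.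
  left; exists (e c); first by rewrite -lts.
  by move=> y cy yx; apply: cU; [rewrite lts|exact: sle].
- move=> a; apply/le_anti; rewrite (sP (e a)).2//= leNgt.
  by apply/negP => /elt; rewrite ltNge (sP (e a)).1.
Qed.

End club.

(** * Diagonal form of an operator at points closed under [H] *)

Lemma continuous_limit_eq0 (K : numFieldType) (g : C0 K) (d : omega1) :
  (exists p : omega1, (p < d)%O) ->
  (forall q, (q < d)%O -> exists2 y, (q < y)%O & (y < d)%O) ->
  (forall y, (y < d)%O -> g y = 0) -> g d = 0.
Proof.
move=> [p pd] lim g0; apply: contrapT => /eqP; rewrite -normr_gt0 => gd.
have : nbhs d [set x | `|g d - g x| < `|g d|].
  by move/cvgrPdist_lt : (@C0_continuous _ g d) => /(_ _ gd).
case/omega1_nbhsE => [[q /lim[y qy yd] /(_ y qy (ltW yd))]|/(_ p (ltW pd))] /=.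
  by rewrite (g0 y)// subr0 ltxx.
by rewrite (g0 p)// subr0 ltxx.
Qed.

Section diagonal.
Variables (K : numFieldType) (T : {linear C0 K -> C0 K}) (M : K).
Hypotheses (M0 : 0 <= M) (TM : forall f, `|T f| <= M * `|f|).
Hypothesis arch : forall x : K, exists n : nat, `|x| < n%:R.
Variable H : omega1 -> omega1.
Hypothesis H_gt : forall p : omega1, (p < H p)%O.
Hypothesis H_right : forall p b x : omega1, (b <= p)%O -> (H p <= x)%O ->
  T (seg K b) x = 0.
Hypothesis H_left : forall p y b b' : omega1, (y <= p)%O ->
  (H p <= b)%O -> (H p <= b')%O -> T (seg K b) y = T (seg K b') y.
Variable d : omega1.
Hypothesis d_min : exists p : omega1, (p < d)%O.
Hypothesis d_closed : forall p, (p < d)%O -> (H p < d)%O.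

(** Below [d] the two functions agree by [H_left], since [H y < d]. As [y < H y < d], the point [d]
    is a limit, and continuity extends the equality to [d]. *)
Lemma diagonal_seg b : (d <= b)%O -> T (seg K b) d = T (seg K d) d.
Proof.
move=> db; apply/eqP; rewrite -subr_eq0 -C0B; apply/eqP.
apply: continuous_limit_eq0 => // [q qd|y yd].
  by exists (H q) => //; exact: d_closed.
rewrite C0B (@H_left y y b d) ?subrr// ?ltW ?d_closed//.
exact: lt_le_trans (d_closed yd) db.
Qed.

(** The difference of both sides is a bounded functional that kills every indicator: by
    [diagonal_seg] when [d <= b], by [H_right] when [b < d]. *)
Lemma diagonalE f : T f d = T (seg K d) d * f d.
Proof.
set l := T (seg K d) d; pose phi g := T g d - l * g d.
suff /eqP : phi f = 0 by rewrite subr_eq0 => /eqP.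
apply: (@form_seg_eq0 _ phi (M + `|l|)); rewrite /phi.
- by rewrite addr_ge0.
- split=> [a g h|g].
    by rewrite linearP !C0D !C0Z mulrDr mulrCA opprD addrACA -mulrBr.
  rewrite (le_trans (ler_normB _ _))// mulrDl lerD//.
    exact: le_trans (C0_norm_ge _ _) (TM g).
  by rewrite normrM ler_wpM2l// C0_norm_ge.
- move=> b; rewrite segE; have [db|bd] := leP d b.
    by rewrite diagonal_seg// mulr1 subrr.
  by rewrite mulr0 subr0 (@H_right b)// ltW// d_closed.
Qed.

Variable c : K.
Hypotheses (c0 : 0 < c) (Tc : forall f, c * `|f| <= `|T f|).

Lemma seg_norm b : `|seg K b| <= 1.
Proof. by apply: C0_norm_le => x; rewrite segE; case: leP; rewrite ?normr1 ?normr0. Qed.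

Lemma diagonal_ge : c / 3 <= `|T (seg K d) d|.
Proof.
(* The ramp [f] below has norm at least [N], whereas [`|T f| <= 2 N eta + M]:
   each [T (seg (xi j))] is small between [p] and [d] except on the gap
   [(H (xi (j - 1)), H (xi j))], and these gaps are disjoint. *)
set eta := c / 3; have eta0 : 0 < eta by rewrite divr_gt0.
rewrite real_leNgt ?(gtr0_real eta0) ?normr_real//; apply/negP => small.
have [p pd pP] : exists2 p : omega1, (p < d)%O & forall x, (p < x)%O -> (x <= d)%O ->
    `|T (seg K d) x| <= eta.
  have : nbhs d [set x | `|T (seg K d) d - T (seg K d) x| < eta - `|T (seg K d) d|].
    by move/cvgrPdist_lt : (@C0_continuous _ (T (seg K d)) d); apply; rewrite subr_gt0.
  have close x : `|T (seg K d) d - T (seg K d) x| < eta - `|T (seg K d) d| ->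
      `|T (seg K d) x| <= eta.
    rewrite distrC ltrBrDr => /ltW; apply: le_trans.
    by rewrite -{1}[T (seg K d) x](subrK (T (seg K d) d)) ler_normD.
  case/omega1_nbhsE => [[p pd pP]|pP].
    by exists p => // x px xd; apply/close/pP.
  by have [p pd] := d_min; exists p => // x px xd; apply/close/pP.
(* Two applications of [H] per step: [T (seg K (xi j))] vanishes from [H (xi j)] on, and up to that
   point all later [T (seg K (xi i))] agree with [T (seg K d)]. Starting at [H p] makes all of them
   agree on [0, p]. *)
pose xi n := iter n (H \o H) (H p).
have xi_d n : (xi n < d)%O.
  by elim: n => [|n IH] /=; rewrite !d_closed.
have xi_lt : {homo xi : m n / (m < n)%N >-> (m < n)%O}.
  apply: homo_ltn => [|n]; first exact: lt_trans.
  exact: lt_trans (H_gt _) (H_gt _).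
have xi_le : {homo xi : m n / (m <= n)%N >-> (m <= n)%O}.
  by move=> m n; rewrite leq_eqVlt => /predU1P[->//|/xi_lt/ltW].
(* The exceptional index is the first [j0] with [x < H (xi j0)]. *)
have xi_seg x : (p < x)%O -> exists j0, forall j, j != j0 ->
    `|T (seg K (xi j)) x| <= eta.
  move=> px; have [[j jP]|nj] := pselect (exists j, (x < H (xi j))%O); last first.
    exists 0%N => j _; rewrite (@H_right (xi j)) ?normr0 ?(ltW eta0)//.
    by rewrite leNgt; apply/negP => xj; apply: nj; exists j.
  have [j0 xj0 j0min] := ex_minnP (ex_intro (fun j => (x < H (xi j))%O) j jP).
  exists j0 => i; rewrite neq_ltn => /orP[ij|ji].
    rewrite (@H_right (xi i)) ?normr0 ?(ltW eta0)// leNgt; apply/negP => /j0min.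
    by rewrite leqNgt ij.
  have Hd := d_closed (xi_d j0).
  rewrite (@H_left (H (xi j0)) x _ d) ?(ltW xj0) ?(ltW (d_closed Hd))//; last exact: xi_le ji.
  by apply: pP => //; rewrite ltW// (lt_trans xj0).
have [N MN] := arch (M / eta).
(* All [N] intervals (xi k, xi (N + k)] contain [xi N], where [f] therefore equals [N]; each of the
   [2 N] endpoints is used once. *)
pose f := \sum_(k < N) (seg K (xi (N + k)%N) - seg K (xi k)).
have fN : N%:R <= `|f|.
  apply: le_trans (C0_norm_ge f (xi N)).
  rewrite C0_sum (eq_bigr (fun=> 1)) => [|k _]; first by rewrite sumr_const card_ord normr_nat.
  by rewrite C0B !segE xi_le ?leq_addr// leNgt xi_lt ?ltn_ord// subr0.
have Tf : `|T f| <= (N + N)%:R * eta + M.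
  apply: C0_norm_le => x; rewrite linear_sum C0_sum.
  have R0 : 0 <= (N + N)%:R * eta + M by rewrite addr_ge0// mulr_ge0// ltW.
  have [xp|px] := leP x p.
    rewrite big1 ?normr0// => k _; rewrite linearB C0B.
    by rewrite (@H_left p x _ (xi k)) ?subrr//; exact: (@xi_le 0%N).
  have [j0 j0P] := xi_seg _ px.
  apply: (@le_trans _ _ (\sum_(j < N + N) (eta + if j == j0 :> nat then M else 0))).
    have G j : `|T (seg K (xi j)) x| <= eta + if j == j0 then M else 0.
      have [_|/j0P] := eqVneq j j0; last by rewrite addr0.
      rewrite (le_trans (le_trans (C0_norm_ge _ _) (TM _)))//.
      by rewrite (le_trans (ler_piMr M0 (seg_norm _)))// lerDr ltW.
    rewrite big_split_ord/= -big_split/= (le_trans (ler_norm_sum _ _ _))//.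
    apply: ler_sum => k _; rewrite linearB C0B (le_trans (ler_normB _ _))// addrC.
    by rewrite lerD.
  rewrite big_split/= sumr_const card_ord -[eta *+ _]mulr_natl lerD2l.
  rewrite -big_mkcond/=.
  have [j0N|Nj0] := ltnP j0 (N + N); last first.
    rewrite big_pred0// => j; apply/negbTE; apply: contraTneq Nj0 => <-.
    by rewrite -ltnNge.
  by rewrite (big_pred1 (Ordinal j0N)).
(* Since [c] is [3 * eta], this forces [N * eta <= M], against the choice of [N]. *)
have : c * N%:R <= (N + N)%:R * eta + M.
  exact: le_trans (le_trans (ler_wpM2l (ltW c0) fN) (Tc f)) Tf.
have c3 : c = eta + eta + eta.
  by rewrite -addrA -mulr2n -mulrS -mulr_natr divfK// pnatr_eq0.
have Mn : M < N%:R * eta.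
  by rewrite -ltr_pdivrMr//; apply: le_lt_trans MN; rewrite ger0_norm ?divr_ge0// ltW.
rewrite {1}c3 natrD !mulrDl ![eta * _]mulrC.
by rewrite lerD2l => /le_lt_trans/(_ Mn); rewrite ltxx.
Qed.

End diagonal.

(** * Continuity and norm bounds of linear maps *)

Lemma linear_le_continuous (K : numFieldType) (V W : normedModType K)
    (f : {linear V -> W}) (M : K) :
  0 <= M -> (forall x, `|f x| <= M * `|x|) -> continuous f.
Proof.
move=> M0 fM; apply: bounded_linear_continuous; apply/linear_boundedP.
near=> r => x; rewrite (le_trans (fM x))// ler_wpM2r//.
by near: r; apply: nbhs_pinfty_ge; exact: ger0_real.
Unshelve. all: by end_near. Qed.

(** The usual rescaling argument, carried out inside [X] because [f] is arbitrary elsewhere. *)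
Lemma linear_on_continuous_bounded (K : numFieldType) (V W : normedModType K)
    (X : set V) (f : V -> W) : submod_closed [in X] -> linear_on X f ->
  {within X, continuous f} -> exists2 M, 0 < M & forall x, X x -> `|f x| <= M * `|x|.
Proof.
move=> [X0 XD] fl /subspace_continuousP fc.
have {}X0 : X 0 by move: X0; rewrite inE.
have XZ a x : X x -> X (a *: x).
  by move=> Xx; rewrite -[a *: x]addr0; apply/set_mem/XD; exact: mem_set.
have f0 : f 0 = 0.
  by have := fl 1 0 0 X0 X0; rewrite !scale1r addr0 => /esym/eqP; rewrite addrC -subr_eq0 addrK => /eqP.
have fZ a x : X x -> f (a *: x) = a *: f x.
  by move=> Xx; have := fl a x 0 Xx X0; rewrite f0 !addr0.
have : \forall y \near (0 : V), X y -> `|f y| < 1.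
  have /cvgrPdist_lt/(_ 1 ltr01) := fc 0 X0.
  rewrite /from_subspace f0 => near1.
  have {}near1 : nbhs (0 : V) [set y | X y -> `|0 - f y| < 1] := near1.
  by apply: filterS near1 => y yX /yX; rewrite sub0r normrN.
move=> /nbhs_norm0P[r /= r0 fr].
(* Rescaling [x] to norm [r / 2] puts it strictly inside the ball of radius [r], where [f] has norm
   below 1. *)
exists (2 / r) => [|x Xx]; first by rewrite divr_gt0.
have [->|x0] := eqVneq x 0; first by rewrite f0 !normr0 mulr0.
have nx0 : 0 < `|x| by rewrite normr_gt0.
have a0 : 0 < r / 2 / `|x| by rewrite !divr_gt0.
have : `|f ((r / 2 / `|x|) *: x)| < 1.
  apply: fr; last exact: XZ.
  rewrite /= normrZ gtr0_norm// divfK ?gt_eqF//.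
  by rewrite ltr_pdivrMr// ltr_pMr// ltr1n.
rewrite fZ// normrZ gtr0_norm// -ltr_pdivlMl// mulr1 => /ltW.
by rewrite !invfM !invrK [r^-1 * _]mulrC.
Qed.

(** * Factorization of the identity through [T] *)

Section factorization.
Variables (K : numFieldType) (T : {linear C0 K -> C0 K}) (M c : K).
Hypotheses (M0 : 0 <= M) (TM : forall f, `|T f| <= M * `|f|).
Hypotheses (c0 : 0 < c) (Tc : forall f, c * `|f| <= `|T f|).
Hypothesis arch : forall x : K, exists n : nat, `|x| < n%:R.

(** By [diagonalE], [T (f \o s)] takes at [e x] the value [lam x * f (s (e x))], which is
    [lam x * f x]. *)
Lemma left_factorization : exists E R : {linear C0 K -> C0 K},
  [/\ continuous E, continuous R & forall f, R (T (E f)) = f].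
Proof.
have /choice[H HP] := operator_separation M0 TM arch.
have H_gt p := let: And3 h _ _ := HP p in h.
have H_right p := let: And3 _ h _ := HP p in h.
have H_left p := let: And3 _ _ h := HP p in h.
(* The first clause excludes the least point, which is vacuously closed under [H]. *)
pose D := [set d : omega1 | (exists p, (p < d)%O) /\ forall p, (p < d)%O -> (H p < d)%O].
have [||e [s [ec sc eD es [le_e e_le s_le]]]] := @club_retraction D.
- move=> p; have [d [pd dH]] := closure_points_unbounded H p.
  by exists d => //; split => //; exists p.
- move=> z p pz zD; split; first by exists p.
  by move=> q /zD[d [_ dH] /andP[/dH Hq dz]]; exact: lt_le_trans Hq dz.
pose lam a := T (seg K (e a)) (e a).
have lam_ge a : c / 3 <= `|lam a|.
  by have [dmin dH] := eD a; exact: (@diagonal_ge K T M M0 TM arch H H_gt H_right H_left).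
have c3 : 0 < c / 3 by rewrite divr_gt0.
have lam0 a : lam a != 0 by rewrite -normr_gt0 (lt_le_trans c3).
(* On the neighbourhood [0, a] of [a], [diagonal_seg] lets the fixed indicator [seg K (e a)] replace
   [seg K (e x)], so [lam] agrees there with a continuous function. *)
have lam_cont : continuous lam.
  move=> a; pose h x := T (seg K (e a)) (e x).
  have hc : h x @[x --> a] --> h a.
    by apply: (@continuous_comp _ _ _ e (T (seg K (e a)))); [exact: ec|exact: C0_continuous].
  apply: cvg_trans hc; apply: (@near_eq_cvg omega1 K (nbhs a) _ h lam).
  apply/omega1_nbhsE; right => x xa.
  have [dmin dH] := eD x; rewrite /h (diagonal_seg H_gt H_left dmin dH)//; exact: e_le.
have EP (f : C0 K) : toC0 (f \o s) = f \o s :> (omega1 -> K).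
  apply: toC0E.
    by move=> x; apply: (@continuous_comp _ _ _ s f); [exact: sc|exact: C0_continuous].
  have [a fa] := C0_eventually f; exists (e a) => x /s_le; rewrite es => /fa.
  by [].
have RP (f : C0 K) : toC0 (fun a => f (e a) / lam a) = (fun a => f (e a) / lam a) :> (omega1 -> K).
  apply: toC0E.
    move=> x; apply: (@cvgM _ _ (nbhs x)).
      by apply: (@continuous_comp _ _ _ e f); [exact: ec|exact: C0_continuous].
    by apply: cvgV => //; exact: lam_cont.
  have [a fa] := C0_eventually f; exists a => x ax.
  by rewrite fa ?mul0r// (le_trans ax).
pose Efun (f : C0 K) := toC0 (f \o s).
pose Rfun (f : C0 K) := toC0 (fun a => f (e a) / lam a).
have El : linear Efun.
  by move=> a f g; apply: C0P => x; rewrite C0D C0Z !EP.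
have Rl : linear Rfun.
  by move=> a f g; apply: C0P => x; rewrite C0D C0Z !RP C0D C0Z mulrDl mulrA.
pose E : {linear C0 K -> C0 K} := HB.pack Efun (GRing.isLinear.Build _ _ _ _ Efun El).
pose R : {linear C0 K -> C0 K} := HB.pack Rfun (GRing.isLinear.Build _ _ _ _ Rfun Rl).
exists E, R; split.
- apply: (@linear_le_continuous _ _ _ _ 1) => // f; rewrite mul1r.
  by apply: C0_norm_le => x; rewrite [E f x](congr1 (@^~ x) (EP f)); exact: C0_norm_ge.
- apply: (@linear_le_continuous _ _ _ _ (c / 3)^-1) => [|f].
    by rewrite invr_ge0 ltW.
  apply: C0_norm_le => x; rewrite [R f x](congr1 (@^~ x) (RP f)).
  by rewrite mulrC normrM normfV ler_pM ?invr_ge0// ?C0_norm_ge// lef_pV2 ?posrE ?normr_gt0.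
- move=> f; apply: C0P => x; rewrite [R _ x](congr1 (@^~ x) (RP _)).
  have [dmin dH] := eD x.
  rewrite (diagonalE M0 TM H_gt H_right H_left dmin dH) -/(lam x).
  by rewrite [E f (e x)](congr1 (@^~ (e x)) (EP f)) /= es mulrAC divff ?mul1r.
Qed.
End factorization.

(** * Scalars, and the complemented copy inside [X] *)

Lemma normed_archimedean (R : realType) (K : numFieldType) :
  K = R :> numFieldType \/ K = R[i] :> numFieldType ->
  forall x : K, exists n : nat, `|x| < n%:R.
Proof.
case=> -> x; first by exists (Num.bound `|x|); exact: archi_boundP.
(* A norm in [R[i]] has zero imaginary part, so bounding its real part suffices. *)
have := normr_ge0 x; rewrite lecE /= => /andP[Im0 Re0].
exists (Num.bound (complex.Re `|x|)); rewrite -(rmorph_nat (real_complex R)) ltcE /=.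
by rewrite eq_sym Im0 archi_boundP.
Qed.

Theorem corollary1p10 (R : realType) (K : numFieldType)
    (hK : K = R :> numFieldType \/ K = R[i] :> numFieldType)
    (X : set (C0 K)) (clX : closed_subspace X)
    (isoX : isomorphic X [set: C0 K]) :
  exists Y : set (C0 K),
    [/\ Y `<=` X, closed_subspace Y, complemented Y
      & isomorphic Y [set: C0 K]].
Proof.
have arch := normed_archimedean hK.
case: clX isoX => Xsub _ [f [g [[_ gX gf fg] [fl fc gc]]]].
have {}gX y : X (g y) by exact: gX.
have {}fg y : f (g y) = y by exact: fg.
have gl : linear g.
  move=> a u v; rewrite -[u in LHS]fg -[v in LHS]fg -fl// gf//.
  by apply/set_mem; apply: Xsub.2; exact: mem_set.
pose T : {linear C0 K -> C0 K} := HB.pack g (GRing.isLinear.Build _ _ _ _ g gl).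
have Tc : continuous T by exact/continuous_subspace_setT.
have [M M0 TM] : exists2 M, 0 < M & forall f, `|T f| <= M * `|f|.
  have /linear_bounded_continuous/linear_boundedP/pinfty_ex_gt0[M M0 TM] := Tc.
  by exists M.
have [M' M'0 fM] := linear_on_continuous_bounded Xsub fl fc.
have c0 : 0 < M'^-1 by rewrite invr_gt0.
(* The bound [M'] for the inverse [f] of [T] becomes a lower bound for [T]. *)
have Tge h : M'^-1 * `|h| <= `|T h|.
  by rewrite -ler_pdivlMl ?invr_gt0// invrK -{1}[h]fg fM.
have [E [S [Ec Sc STE]]] := left_factorization (ltW M0) TM c0 Tge arch.
(* [S] is a left inverse of [T \o E], so [P] is a projection, and its range lies in the range of
   [T], hence in [X]. *)
pose P : {linear C0 K -> C0 K} := T \o E \o S.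
have Pc : continuous P.
  move=> h; apply: continuous_comp; first exact: Sc.
  by apply: continuous_comp; [exact: Ec|exact: Tc].
have PP h : P (P h) = P h by rewrite /P /= STE.
have PE : range P = [set h | P h = h].
  by apply/seteqP; split => [_ [h _ <-]//|h <-]; exists (P h).
exists (range P); split.
- by move=> _ [h _ <-]; exact: gX.
- split.
    split; first by rewrite inE; exists 0; rewrite ?linear0.
    move=> a u v /set_mem[u' _ <-] /set_mem[v' _ <-]; apply/mem_set.
    by exists (a *: u' + v'); rewrite ?linearP.
  (* The range is closed as the kernel of the continuous map [h - P h]. *)
  rewrite PE (_ : [set h | P h = h] = (fun h => h - P h) @^-1` [set 0]); last first.
    apply/seteqP; split => h /= => [->|/eqP]; first by rewrite subrr.
    by rewrite subr_eq0 => /eqP.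
  apply: closed_comp => [h _|].
    by apply: (@cvgB _ _ _ (nbhs h)); [exact: cvg_id|exact: Pc].
  by apply: accessible_closed_set1; apply: hausdorff_accessible; exact: norm_hausdorff.
- by exists P.
- exists S, (T \o E); split; split => //.
  + by move=> h _; exists (T (E h)) => //; rewrite /P /= STE.
  + by move=> _ [h _ <-]; rewrite /P /= STE.
  + by move=> h _; exact: STE.
  + by move=> a u v _ _; exact: linearP.
  + exact: continuous_subspaceT.
  + apply: continuous_subspaceT => h.
    by apply: continuous_comp; [exact: Ec|exact: Tc].
Qed.
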